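(* There are $\mathcal{O}(n^2 \log^2 n)$ 2D-runs in an $n \times n$ array $A$.
   Context: For an $m\times n$ array $A$, $A[i_1\,..\,i_2,j_1\,..\,j_2]$ is the subarray formed by rows $i_1,\dots,i_2$ and columns $j_1,\dots,j_2$. A positive integer $p$ is a horizontal period of an array $B$ if the $i$-th column of $B$ equals the $(i+p)$-th column for all valid $i$; $\mathsf{hper}(B)$ is the smallest horizontal period. Similarly, $q$ is a vertical period if the $i$-th row equals the $(i+q)$-th row for all valid $i$; $\mathsf{vper}(B)$ is the smallest vertical period. An $r\times c$ subarray $B=A[i_1\,..\,i_2,j_1\,..\,j_2]$ is a 2D-run if $\mathsf{hper}(B)\le c/2$, $\mathsf{vper}(B)\le r/2$, and extending $B$ by a row or column (i.e., by any of $A[i_1-1,j_1\,..\,j_2]$, $A[i_2+1,j_1\,..\,j_2]$, $A[i_1\,..\,i_2,j_1-1]$, $A[i_1\,..\,i_2,j_2+1]$ that exists) would change its smallest vertical or smallest horizontal period. 2D-runs are counted as positioned subarrays (different positions count as different 2D-runs). *)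

(* Defs.v *)
From mathcomp Require Import all_boot all_order all_algebra.
From mathcomp Require Import reals exp.

Set Implicit Arguments.
Unset Strict Implicit.
Unset Printing Implicit Defensive.

Section Periods.
Variables (T : eqType) (r c : nat).
Implicit Type B : 'M[T]_(r, c).

(* Every p >= c is vacuously a horizontal period of an array with c columns,
   so that a smallest one always exists; likewise for rows. *)
Definition is_hperiod B (p : nat) : bool :=
  (0 < p) &&
  [forall i : 'I_c, forall j : 'I_c, (j == i + p :> nat) ==> (col i B == col j B)].

Definition is_vperiod B (q : nat) : bool :=
  (0 < q) &&
  [forall i : 'I_r, forall j : 'I_r, (j == i + q :> nat) ==> (row i B == row j B)].

Lemma hperiod_exists B : exists p, is_hperiod B p.
Proof.
exists c.+1; apply/forallP => i; apply/forallP => j; apply/implyP => /eqP jE.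
by have := ltn_ord j; rewrite jE addnS ltnNge leqW // leq_addl.
Qed.

Lemma vperiod_exists B : exists q, is_vperiod B q.
Proof.
exists r.+1; apply/forallP => i; apply/forallP => j; apply/implyP => /eqP jE.
by have := ltn_ord j; rewrite jE addnS ltnNge leqW // leq_addl.
Qed.

Definition hper B : nat := ex_minn (hperiod_exists B).
Definition vper B : nat := ex_minn (vperiod_exists B).

End Periods.

Lemma shift_ord_subproof m (i1 i2 : 'I_m) (k : 'I_(i2 - i1).+1) : i1 + k < m.
Proof.
have k_le : k <= i2 - i1 by rewrite -ltnS.
have := leq_add (leqnn i1) k_le; rewrite -maxnE => /leq_ltn_trans; apply.
by rewrite gtn_max !ltn_ord.
Qed.

Definition shift_ord m (i1 i2 : 'I_m) (k : 'I_(i2 - i1).+1) : 'I_m :=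
  Ordinal (shift_ord_subproof k).

(* A[i1 .. i2, j1 .. j2] with both bounds inclusive and 0-based; it is
   meaningful only when i1 <= i2 and j1 <= j2. *)
Definition subarray (T : Type) m n (A : 'M[T]_(m, n)) (i1 i2 : 'I_m)
    (j1 j2 : 'I_n) : 'M[T]_((i2 - i1).+1, (j2 - j1).+1) :=
  mxsub (@shift_ord m i1 i2) (@shift_ord n j1 j2) A.

Definition same_periods (T : eqType) r c r' c'
    (B : 'M[T]_(r, c)) (B' : 'M[T]_(r', c')) : bool :=
  (vper B == vper B') && (hper B == hper B').

(* An extension of the subarray by one row or column is required to change
   the periods only if that row or column exists in A, whence the
   quantification over neighbouring valid indices. *)
Definition is_2Drun (T : eqType) m n (A : 'M[T]_(m, n)) (i1 i2 : 'I_m)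
    (j1 j2 : 'I_n) : bool :=
  let B := subarray A i1 i2 j1 j2 in
  [&& i1 <= i2, j1 <= j2,
      2 * hper B <= (j2 - j1).+1,
      2 * vper B <= (i2 - i1).+1,
      [forall i : 'I_m, (i.+1 == i1) ==> ~~ same_periods B (subarray A i i2 j1 j2)],
      [forall i : 'I_m, (i == i2.+1 :> nat) ==> ~~ same_periods B (subarray A i1 i j1 j2)],
      [forall j : 'I_n, (j.+1 == j1) ==> ~~ same_periods B (subarray A i1 i2 j j2)]
    & [forall j : 'I_n, (j == j2.+1 :> nat) ==> ~~ same_periods B (subarray A i1 i2 j1 j)]].

Definition runs2D (T : eqType) m n (A : 'M[T]_(m, n)) :
    {set ('I_m * 'I_m) * ('I_n * 'I_n)} :=
  [set x | is_2Drun A x.1.1 x.1.2 x.2.1 x.2.2].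

(* Main.v *)
(* A 2D-run with top row i, smallest horizontal period p and smallest vertical
   period q is charged to a column x such that the window of width 2p starting
   at x lies in the run and loses a period when extended by the row below the
   run (or the run touches the bottom of the array). Given (i, x, p, q), the
   bottom row is forced, and then so are the left and right columns, since runs
   sharing a window of width 2p can be merged.
   A horizontal strip of height h, q <= h <= 2q, starting at row i contains all
   distinct rows of the run, so its columns, seen as letters, form a primitive
   square of period p at x; here h is chosen to depend only on the dyadic scale
   of q. Likewise the rows of the vertical strip of p columns starting at x form
   a primitive square of period q at i. By the three squares lemma at most two
   primitive squares with periods in [2^k, 2^(k+1)) start at a given position:
   given (i, x) and the scales of p and q there are at most two values of p and,
   for each, two values of q. *)

Require Import Defs.
From mathcomp Require Import all_boot all_order all_algebra.
From mathcomp Require Import reals exp.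
From mathcomp Require Import boolp zify ring lra.

Import Order.TTheory GRing.Theory Num.Theory.

Set Implicit Arguments.
Unset Strict Implicit.
Unset Printing Implicit Defensive.

(** * Periods of a word on an interval *)

Definition has_period (X : Type) (f : nat -> X) (x l p : nat) : Prop :=
  forall k, x <= k -> k + p < x + l -> f k = f (k + p).

Lemma has_periodS (X : Type) (f : nat -> X) x l y m p :
  has_period f x l p -> x <= y -> y + m <= x + l -> has_period f y m p.
Proof. by move=> H xy ym k yk km; apply: H; lia. Qed.

Lemma has_periodU (X : Type) (f : nat -> X) x l y m p :
  has_period f x l p -> has_period f y m p -> x <= y -> y + p <= x + l ->
  has_period f x (y + m - x) p.
Proof.
move=> Hx Hy xy yp k xk km; have [kl|lk] := ltnP (k + p) (x + l).
  exact: Hx.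
by apply: Hy; lia.
Qed.

Lemma has_period_mod (X : Type) (f : nat -> X) x l p k k' :
  has_period f x l p -> x <= k < x + l -> x <= k' < x + l ->
  k = k' %[mod p] -> f k = f k'.
Proof.
move=> H.
wlog kk' : k k' / k <= k'.
  move=> W Hk Hk' E; case/orP: (leq_total k k') => le; first exact: W.
  by symmetry; apply: W.
move=> /andP[xk _] /andP[_ k'l] /esym/eqP; rewrite eqn_mod_dvd // => /dvdnP[t E].
have {E} Ek' : k' = k + t * p by rewrite -E subnKC.
move: k'l; rewrite {kk'}Ek'; elim: t => [|t IH] tl; first by rewrite mul0n addn0.
rewrite IH; last by move: tl; rewrite mulSn; lia.
by rewrite mulSn [p + _]addnC addnA; apply: H; move: tl; rewrite mulSn; lia.
Qed.

Lemma mod_representative p y k :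
  0 < p -> exists2 k', y <= k' < y + p & k = k' %[mod p].
Proof.
(* The term [y * p.-1] plays the role of [-y] modulo [p]. *)
move=> p0; exists (y + (k + y * p.-1) %% p).
  by rewrite leq_addr ltn_add2l ltn_pmod.
rewrite modnDmr addnCA -mulnS prednK //.
by rewrite -modnDmr modnMl addn0.
Qed.

(** Reduction modulo [p] moves [k] and [k + d] into the window, where their images differ by a
    multiple of [d] because [d] divides [p]. *)
Lemma has_period_window (X : Type) (f : nat -> X) x l y m p d :
  0 < p -> p <= m -> x <= y -> y + m <= x + l -> d %| p ->
  has_period f x l p -> has_period f y m d -> has_period f x l d.
Proof.
move=> p0 pm xy ym dp Hp Hd k xk kl.
have [k1 k1y E1] := mod_representative y k p0.
have [k2 k2y E2] := mod_representative y (k + d) p0.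
rewrite (has_period_mod (k := k) (k' := k1) Hp) //; try lia.
rewrite (has_period_mod (k := k + d) (k' := k2) Hp) //; try lia.
apply: (has_period_mod Hd); [lia | lia |].
rewrite -(modn_dvdm k1 dp) -E1 modn_dvdm // -(modn_dvdm k2 dp) -E2 modn_dvdm //.
by rewrite modnDr.
Qed.

(** Weak form of the Fine and Wilf theorem, by the subtractive Euclidean algorithm. *)
Lemma has_period_gcd (X : Type) (f : nat -> X) x l p q :
  0 < p -> 0 < q -> p + q <= l ->
  has_period f x l p -> has_period f x l q -> has_period f x l (gcdn p q).
Proof.
have [n] := ubnP (p + q); elim: n p q => // n IH p q pqn p0 q0 pql Hp Hq.
wlog pq : p q pqn p0 q0 pql Hp Hq / p <= q.
  move=> W; case/orP: (leq_total p q) => le; first exact: W.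
  by rewrite gcdnC; apply: W => //; rewrite addnC.
have [<-|neq] := eqVneq p q; first by rewrite gcdnn.
have ltpq : p < q by rewrite ltn_neqAle neq.
have -> : gcdn p q = gcdn p (q - p) by rewrite -{1}(subnKC pq) gcdnDl.
apply: IH => //; try lia.
(* The shift by [q - p] goes up by [q] and then down by [p], or down first when [k + q] leaves the
   interval. *)
move=> k xk kl; have [kq|kq] := ltnP (k + q) (x + l).
  rewrite Hq // (Hp (k + (q - p))); try lia.
  by congr f; lia.
have E := Hp (k - p); rewrite subnK in E; last by lia.
rewrite -E; try lia.
by rewrite Hq; try lia; congr f; lia.
Qed.

(** * Primitive squares and the three squares lemma *)

(** A square [uu] with [u] of length [p]; by Fine and Wilf, the absence of a smaller period amounts
    to primitivity of [u]. *)
Definition primitive_square (X : Type) (f : nat -> X) (x p : nat) : Prop :=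
  [/\ 0 < p, has_period f x (2 * p) p
    & forall d, 0 < d < p -> ~ has_period f x (2 * p) d].

Lemma has_period_diff (X : Type) (f : nat -> X) x p q :
  p <= q -> has_period f x (2 * p) p -> has_period f x (2 * q) q ->
  has_period f (x + p) q (q - p) /\ has_period f x p (q - p).
Proof.
move=> pq Hp Hq.
have H1 : has_period f (x + p) q (q - p).
  move=> k xk kq.
  have := Hp (k - p); rewrite subnK; last by lia.
  move=> <-; try lia.
  by rewrite Hq; try lia; congr f; lia.
split=> // k xk kp.
rewrite Hp; try lia.
rewrite (Hp (k + (q - p))); try lia.
by rewrite H1; try lia; congr f; lia.
Qed.

(* If p3 < 2 p1, then p3 - p2 and p2 - p1 are both periods of the first
   half of the shortest square, and so is their gcd d; the periodicity then
   spreads to the whole shortest square, contradicting primitivity. *)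
Lemma three_squares (X : Type) (f : nat -> X) x p1 p2 p3 :
  p1 < p2 -> p2 < p3 -> primitive_square f x p1 -> primitive_square f x p2 ->
  primitive_square f x p3 -> 2 * p1 <= p3.
Proof.
move=> p12 p23 [p10 H1 min1] [p20 H2 _] [p30 H3 _].
rewrite leqNgt; apply/negP => p3lt.
have [H12 H12'] := has_period_diff (ltnW p12) H1 H2.
have [_ H23] := has_period_diff (ltnW p23) H2 H3.
set d := gcdn (p3 - p2) (p2 - p1).
have d0 : 0 < d by rewrite gcdn_gt0 subn_gt0 p23.
have dd1 : d %| p2 - p1 by apply: dvdn_gcdr.
have dd2 : d %| p3 - p2 by apply: dvdn_gcdl.
have dle1 : d <= p2 - p1 by apply: dvdn_leq => //; lia.
(* Since [p3 < 2 * p1], the two differences sum to less than [p1], as the gcd lemma requires. *)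
have Hd1 : has_period f x p1 d.
  apply: has_period_gcd; try lia; last exact: H12'.
  by apply: has_periodS H23 _ _; lia.
have Hd2 : has_period f x p2 d.
  by apply: (has_period_window (y := x) (m := p1) (p := p3 - p2)) => //; lia.
(* One full period [p2 - p1] of this interval, [[x + p1, x + p2)], lies in the prefix that already
   has period [d]. *)
have Hd3 : has_period f (x + p1) p2 d.
  apply: (has_period_window (y := x + p1) (m := p2 - p1) (p := p2 - p1)) => //; try lia.
  by apply: has_periodS Hd2 _ _; lia.
apply: (min1 d); first by lia.
have := has_periodU Hd2 Hd3; move=> /(_ ltac:(lia) ltac:(lia)) Hd.
by apply: has_periodS Hd _ _; lia.
Qed.

(** * Periodicity in two dimensions *)

Definition transposed (X : Type) (g : nat -> nat -> X) : nat -> nat -> X :=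
  fun i j => g j i.

Definition hperiodic (X : Type) (g : nat -> nat -> X) (i r j c p : nat) : Prop :=
  forall k, i <= k < i + r -> has_period (g k) j c p.

Definition biperiodic (X : Type) (g : nat -> nat -> X) (i r j c p q : nat) : Prop :=
  hperiodic g i r j c p /\ hperiodic (transposed g) j c i r q.

Definition strip (X : Type) (g : nat -> nat -> X) (i h : nat) (j : nat) : seq X :=
  [seq g k j | k <- iota i h].

Lemma strip_period (X : eqType) (g : nat -> nat -> X) i h j c p :
  has_period (strip g i h) j c p <-> hperiodic g i h j c p.
Proof.
split=> [H k kh x jx xc | H x jx xc].
  have /eq_in_map := H x jx xc; apply.
  by rewrite mem_iota.
apply/eq_in_map => k; rewrite mem_iota => kh.
exact: H.
Qed.

Lemma biperiodicS (X : Type) (g : nat -> nat -> X) i r j c p q i' r' j' c' :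
  biperiodic g i r j c p q -> i <= i' -> i' + r' <= i + r ->
  j <= j' -> j' + c' <= j + c -> biperiodic g i' r' j' c' p q.
Proof.
move=> [H V] ii' r'r jj' c'c; split=> k kr.
  by apply: has_periodS (H k _) _ _; lia.
by apply: has_periodS (V k _) _ _; lia.
Qed.

Lemma biperiodicU (X : Type) (g : nat -> nat -> X) i r j c j' c' p q :
  biperiodic g i r j c p q -> biperiodic g i r j' c' p q ->
  j <= j' -> j' + p <= j + c -> biperiodic g i r j (j' + c' - j) p q.
Proof.
move=> [H V] [H' V'] jj' jp; split=> k kr.
  exact: has_periodU (H k kr) (H' k kr) jj' jp.
have [kc|kc] := ltnP k (j + c); first by apply: V; lia.
by apply: V'; lia.
Qed.

(** Cells of a row at distance [p] share a window of width [2 * p], so a loss of biperiodicity shows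
    in a single window; this supplies anchors. *)
Lemma biperiodic_windows (X : Type) (g : nat -> nat -> X) i r j c p q :
  0 < p -> 2 * p <= c ->
  (forall x, j <= x -> x + 2 * p <= j + c -> biperiodic g i r x (2 * p) p q) ->
  biperiodic g i r j c p q.
Proof.
move=> p0 pc W; split.
  move=> k kr x jx xc.
  have [H _] := W (minn x (j + c - 2 * p)) ltac:(lia) ltac:(lia).
  by apply: (H k kr); lia.
move=> k kr.
have [_ V] := W (minn k (j + c - 2 * p)) ltac:(lia) ltac:(lia).
by apply: V; lia.
Qed.

(** If the strip had a smaller period [d], then [gcdn d p] would spread from the window to the full
    width, and to every row of the run, since each equals one of the [h >= q] rows of the strip.
    This contradicts the minimality of [p]. *)
Lemma strip_primitive_square (X : eqType) (g : nat -> nat -> X) i r j c p q y h x :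
  0 < p -> 0 < q -> biperiodic g i r j c p q ->
  (forall d, 0 < d < p -> ~ hperiodic g i r j c d) ->
  i <= y -> y + h <= i + r -> q <= h -> j <= x -> x + 2 * p <= j + c ->
  primitive_square (strip g y h) x p.
Proof.
move=> p0 q0 [H V] minp iy yh qh jx xc.
have Hs : hperiodic g y h x (2 * p) p.
  by move=> k kh; apply: has_periodS (H k _) _ _; lia.
split=> //; first by apply/strip_period.
move=> d /andP[d0 dp] Hd.
have {Hd} : has_period (strip g y h) x (2 * p) (gcdn d p).
  by apply: has_period_gcd => //; [lia | apply/strip_period].
move/strip_period => Hd.
apply: (minp (gcdn d p)).
  rewrite gcdn_gt0 d0 /=; apply: leq_ltn_trans dp.
  by apply: dvdn_leq => //; apply: dvdn_gcdl.
move=> k kr z jz zc; have zjc := leq_ltn_trans (leq_addr _ _) zc.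
have [k' k'y E] := mod_representative y k q0.
have row_eq z' : j <= z' < j + c -> g k z' = g k' z'.
  move=> z'c; apply: (has_period_mod (V z' z'c)) => //; lia.
rewrite !row_eq ?jz ?zc ?zjc ?(leq_trans jz) ?leq_addr //.
have Hk' : has_period (g k') j c p by apply: H; lia.
have Hk'd : has_period (g k') x (2 * p) (gcdn d p) by apply: Hd; lia.
have := has_period_window p0 _ jx xc (dvdn_gcdr d p) Hk' Hk'd.
by apply => //; lia.
Qed.

(** * Runs in natural coordinates and their anchors *)

(** The corner is [(i, j)], the height [r], the width [c]. Maximality is phrased as the loss of one
    of the periods [p], [q] rather than as a change of a smallest period. *)
Record nat_run (X : Type) (g : nat -> nat -> X) (n i r j c p q : nat) : Prop := {
  run_p_gt0 : 0 < p;
  run_q_gt0 : 0 < q;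
  run_width : 2 * p <= c;
  run_height : 2 * q <= r;
  run_bottom : i + r <= n;
  run_right : j + c <= n;
  run_periodic : biperiodic g i r j c p q;
  run_p_min : forall d, 0 < d < p -> ~ hperiodic g i r j c d;
  run_q_min : forall d, 0 < d < q -> ~ hperiodic (transposed g) j c i r d;
  run_max_down : i + r < n -> ~ biperiodic g i r.+1 j c p q;
  run_max_left : 0 < j -> ~ biperiodic g i r j.-1 c.+1 p q;
  run_max_right : j + c < n -> ~ biperiodic g i r j c.+1 p q
}.

Definition anchor (X : Type) (g : nat -> nat -> X) (n i r j c p q x : nat) : Prop :=
  [/\ j <= x, x + 2 * p <= j + c
    & i + r = n \/ ~ biperiodic g i r.+1 x (2 * p) p q].

Lemma anchor_exists (X : Type) (g : nat -> nat -> X) n i r j c p q :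
  nat_run g n i r j c p q -> exists x, anchor g n i r j c p q x.
Proof.
move=> B; have [p0 pc] := (run_p_gt0 B, run_width B).
have [E|lt] : i + r = n \/ i + r < n by have := run_bottom B; lia.
  by exists j; split; [lia | lia | left].
apply: contrapT => noanchor; apply: (run_max_down B lt).
apply: biperiodic_windows => // x jx xc; apply: contrapT => nb.
by apply: noanchor; exists x; split=> //; right.
Qed.

Lemma anchor_inj (X : Type) (g : nat -> nat -> X) n i p q x r j c r' j' c' :
  nat_run g n i r j c p q -> anchor g n i r j c p q x ->
  nat_run g n i r' j' c' p q -> anchor g n i r' j' c' p q x ->
  [/\ r = r', j = j' & c = c'].
Proof.
(* A taller run would contain the anchored window extended by the next row. *)
have le_r r1 j1 c1 r2 j2 c2 : nat_run g n i r1 j1 c1 p q ->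
    anchor g n i r1 j1 c1 p q x -> nat_run g n i r2 j2 c2 p q ->
    anchor g n i r2 j2 c2 p q x -> r2 <= r1.
  move=> B1 [_ _ A1] B2 [jx2 xc2 _]; rewrite leqNgt; apply/negP => lt.
  have := run_bottom B2.
  case: A1 => [E|nb]; first by lia.
  move=> _; apply: nb; apply: biperiodicS (run_periodic B2) _ _ _ _; lia.
(* Both runs contain the window at [x], so their union is biperiodic and would extend the first run
   to the left. *)
have le_j r1 j1 c1 j2 c2 : nat_run g n i r1 j1 c1 p q ->
    anchor g n i r1 j1 c1 p q x -> nat_run g n i r1 j2 c2 p q ->
    anchor g n i r1 j2 c2 p q x -> j1 <= j2.
  move=> B1 [jx1 xc1 _] B2 [jx2 xc2 _]; rewrite leqNgt; apply/negP => lt.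
  apply: (run_max_left B1); first by lia.
  have := biperiodicU (run_periodic B2)
    (run_periodic B1) (ltnW lt) ltac:(lia).
  by move/biperiodicS; apply; lia.
have le_c r1 j1 c1 c2 : nat_run g n i r1 j1 c1 p q ->
    nat_run g n i r1 j1 c2 p q -> c2 <= c1.
  move=> B1 B2; rewrite leqNgt; apply/negP => lt.
  apply: (run_max_right B1).
    by have := run_right B2; lia.
  by apply: biperiodicS (run_periodic B2) _ _ _ _; lia.
move=> B1 A1 B2 A2.
have Er : r = r' by apply/eqP; rewrite eqn_leq !(le_r _ _ _ _ _ _ B1 A1 B2 A2, le_r _ _ _ _ _ _ B2 A2 B1 A1).
subst r'.
have Ej : j = j' by apply/eqP; rewrite eqn_leq !(le_j _ _ _ _ _ B1 A1 B2 A2, le_j _ _ _ _ _ B2 A2 B1 A1).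
subst j'.
by split=> //; apply/eqP; rewrite eqn_leq !(le_c _ _ _ _ B1 B2, le_c _ _ _ _ B2 B1).
Qed.

(** * Recovering a run from its code *)

(* At most two periods of primitive squares at x share a binary logarithm, so
   this predicate identifies p among them. *)
Definition second_square (X : Type) (f : nat -> X) (x p : nat) : Prop :=
  exists2 p', p' < p /\ trunc_log 2 p' = trunc_log 2 p & primitive_square f x p'.

(** If [p < p'], then [p] makes [p'] a second square, hence [p] is one too, and some [p0 < p] has
    the same scale. Then [p' < 2 * p0], against the three squares lemma. *)
Lemma square_period_inj (X : Type) (f : nat -> X) x p p' :
  primitive_square f x p -> primitive_square f x p' ->
  trunc_log 2 p = trunc_log 2 p' ->
  `[< second_square f x p >] = `[< second_square f x p' >] -> p = p'.
Proof.
wlog le : p p' / p <= p'.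
  move=> W S S' E E2; case/orP: (leq_total p p') => le; first exact: W.
  by symmetry; apply: W.
move=> S S' E.
move: le; rewrite leq_eqVlt => /orP[/eqP //|lt].
have -> : `[< second_square f x p' >] = true.
  by apply/asboolP; exists p.
move/asboolP => [p0 [p0p E0] S0].
have := three_squares p0p lt S0 S S'.
have [[p0_gt0 _ _] [p'_gt0 _ _]] := (S0, S').
have /andP[le0 _] := trunc_log_bounds (isT : 1 < 2) p0_gt0.
have /andP[_ lt0] := trunc_log_bounds (isT : 1 < 2) p'_gt0.
by move: lt0; rewrite -E -E0 expnS; lia.
Qed.

Lemma run_squares (X : eqType) (g : nat -> nat -> X) n i r j c p q x :
  nat_run g n i r j c p q -> anchor g n i r j c p q x ->
  primitive_square (strip g i (2 ^ (trunc_log 2 q).+1)) x p /\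
  primitive_square (strip (transposed g) x p) i q.
Proof.
move=> B [jx xc _]; have q0 := run_q_gt0 B; have p0 := run_p_gt0 B.
have rq := run_height B.
have /andP[le_q lt_q] := trunc_log_bounds (isT : 1 < 2) q0.
have [H V] := run_periodic B; split.
  apply: (strip_primitive_square p0 q0 (run_periodic B) (run_p_min B)) => //.
  - by rewrite leq_add2l expnS; lia.
  - exact: ltnW.
apply: (strip_primitive_square q0 p0 (conj V H) (run_q_min B)) => //; lia.
Qed.

Definition square_ranks (X : Type) (g : nat -> nat -> X) (i x p q : nat) : bool * bool :=
  (`[< second_square (strip g i (2 ^ (trunc_log 2 q).+1)) x p >],
   `[< second_square (strip (transposed g) x p) i q >]).

(** The order matters: the horizontal strip depends only on the scale of [q], so [p] is found first;
    the vertical strip has [p] columns and then yields [q]. *)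
Lemma run_inj (X : eqType) (g : nat -> nat -> X) n i x r j c p q r' j' c' p' q' :
  nat_run g n i r j c p q -> anchor g n i r j c p q x ->
  nat_run g n i r' j' c' p' q' -> anchor g n i r' j' c' p' q' x ->
  trunc_log 2 p = trunc_log 2 p' -> trunc_log 2 q = trunc_log 2 q' ->
  square_ranks g i x p q = square_ranks g i x p' q' ->
  [/\ r = r', j = j' & c = c'].
Proof.
move=> B A B' A' Ep Eq.
have [Sp Sq] := run_squares B A; have [Sp' Sq'] := run_squares B' A'.
rewrite /square_ranks -Eq in Sp' * => -[Ep2 Eq2].
have Epp := square_period_inj Sp Sp' Ep Ep2.
rewrite -Epp in Sq' B' A' Eq2.
have Eqq := square_period_inj Sq Sq' Eq Eq2.
rewrite -Eqq in B' A'.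
exact: anchor_inj B A B' A'.
Qed.

(** Any choice of witnesses is injective, so anchors need not be given by an explicit function. *)
Lemma leq_card_rel (U W : finType) (D : {set U}) (P : U -> W -> Prop) :
  (forall u, u \in D -> exists w, P u w) ->
  (forall u v w, P u w -> P v w -> u = v) -> #|D| <= #|W|.
Proof.
move=> ex inj.
have /choice[f Pf] : forall u : {u | u \in D}, exists w, P (sval u) w.
  by case=> u uD; apply: ex.
rewrite -[#|D|](card_sig (mem D)); apply: (@leq_card _ _ f) => u v Efuv.
apply: val_inj; apply: inj (Pf u) _; rewrite Efuv; exact: Pf.
Qed.

(** * From matrices to functions on natural numbers *)

(** The value [None] outside the array makes indexing total, so subarrays of different sizes are
    compared without dependent types. *)
Definition ext (T : Type) m n (A : 'M[T]_(m, n)) (i j : nat) : option T :=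
  if (insub i, insub j) is (Some i', Some j') then Some (A i' j') else None.

Section Bridge.
Variable T : eqType.

Lemma ext_ord m n (A : 'M[T]_(m, n)) (i : 'I_m) (j : 'I_n) :
  ext A i j = Some (A i j).
Proof. by rewrite /ext !valK. Qed.

Lemma ext_tr m n (A : 'M[T]_(m, n)) : ext A^T%R = transposed (ext A).
Proof.
apply/funext => i; apply/funext => j; rewrite /ext /transposed.
by do 2![case: insub => [?|] //]; rewrite mxE.
Qed.

Lemma hperiodP m n (A : 'M[T]_(m, n)) (i1 i2 : 'I_m) (j1 j2 : 'I_n) p :
  reflect (0 < p /\ hperiodic (ext A) i1 (i2 - i1).+1 j1 (j2 - j1).+1 p)
    (is_hperiod (subarray A i1 i2 j1 j2) p).
Proof.
apply: (iffP andP) => -[p0 H]; split=> //.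
  move=> k /andP[k1 k2] x x1 x2.
  have kr : k - i1 < (i2 - i1).+1 by lia.
  have xr : x - j1 < (j2 - j1).+1 by lia.
  have pr : x - j1 + p < (j2 - j1).+1 by lia.
  have /implyP/(_ (eqxx _))/eqP E := forallP (forallP H (Ordinal xr)) (Ordinal pr).
  have := congr1 (fun C : 'cV_ _ => Some (C (Ordinal kr) ord0)) E.
  rewrite !mxE -!ext_ord /=.
  by rewrite subnKC // addnA subnKC.
apply/forallP => a; apply/forallP => b; apply/implyP => /eqP Eb.
apply/eqP/colP => k; rewrite !mxE; apply: Some_inj; rewrite -!ext_ord /= Eb addnA.
have := ltn_ord k; have := ltn_ord b; rewrite Eb => br kr.
by apply: H; lia.
Qed.

Lemma vperiod_tr m n (B : 'M[T]_(m, n)) q : is_vperiod B q = is_hperiod B^T%R q.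
Proof.
congr (_ && _); apply: eq_forallb => a; apply: eq_forallb => b; congr (_ ==> _).
by rewrite -!tr_row (inj_eq (@trmx_inj _ _ _)).
Qed.

Lemma subarray_tr m n (A : 'M[T]_(m, n)) i1 i2 j1 j2 :
  (subarray A i1 i2 j1 j2)^T%R = subarray A^T%R j1 j2 i1 i2.
Proof. exact: trmx_mxsub. Qed.

Lemma vperiodP m n (A : 'M[T]_(m, n)) (i1 i2 : 'I_m) (j1 j2 : 'I_n) q :
  reflect (0 < q /\ hperiodic (transposed (ext A)) j1 (j2 - j1).+1 i1 (i2 - i1).+1 q)
    (is_vperiod (subarray A i1 i2 j1 j2) q).
Proof. by rewrite vperiod_tr subarray_tr -ext_tr; apply: hperiodP. Qed.

Lemma hperP m n (B : 'M[T]_(m, n)) p :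
  is_hperiod B p -> (forall d, is_hperiod B d -> p <= d) -> hper B = p.
Proof.
rewrite /hper; case: ex_minnP => h Hh minh Hp minp.
by apply/eqP; rewrite eqn_leq minh //= minp.
Qed.

Lemma vperP m n (B : 'M[T]_(m, n)) q :
  is_vperiod B q -> (forall d, is_vperiod B d -> q <= d) -> vper B = q.
Proof.
rewrite /vper; case: ex_minnP => h Hh minh Hp minp.
by apply/eqP; rewrite eqn_leq minh //= minp.
Qed.

Lemma hper_period m n (B : 'M[T]_(m, n)) :
  is_hperiod B (hper B) /\ forall d, is_hperiod B d -> hper B <= d.
Proof. by rewrite /hper; case: ex_minnP. Qed.

Lemma vper_period m n (B : 'M[T]_(m, n)) :
  is_vperiod B (vper B) /\ forall d, is_vperiod B d -> vper B <= d.
Proof. by rewrite /vper; case: ex_minnP. Qed.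

(* Enlarging a subarray can only remove periods, so its smallest periods
   persist as soon as they are still periods. *)
Lemma same_periods_ext m n (A : 'M[T]_(m, n)) (i1 i2 i1' i2' : 'I_m)
    (j1 j2 j1' j2' : 'I_n) :
  i1 <= i2 -> j1 <= j2 ->
  i1' <= i1 -> i2 <= i2' -> j1' <= j1 -> j2 <= j2' ->
  let B := subarray A i1 i2 j1 j2 in
  biperiodic (ext A) i1' (i2' - i1').+1 j1' (j2' - j1').+1 (hper B) (vper B) ->
  same_periods B (subarray A i1' i2' j1' j2').
Proof.
move=> i12 j12 ii1 ii2 jj1 jj2 B [H V].
have [/hperiodP[p0 _] minp] := hper_period B.
have [/vperiodP[q0 _] minq] := vper_period B.
apply/andP; split; apply/eqP/esym.
  apply: vperP; first by apply/vperiodP.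
  move=> d /vperiodP[d0 Hd]; apply: minq; apply/vperiodP; split=> // k kr.
  by apply: has_periodS (Hd k _) _ _; lia.
apply: hperP; first by apply/hperiodP.
move=> d /hperiodP[d0 Hd]; apply: minp; apply/hperiodP; split=> // k kr.
by apply: has_periodS (Hd k _) _ _; lia.
Qed.

(** Each maximality field is the contrapositive of [same_periods_ext] for an enlargement by one row
    or column. *)
Lemma is_2Drun_nat_run n (A : 'M[T]_(n, n)) (i1 i2 j1 j2 : 'I_n) :
  is_2Drun A i1 i2 j1 j2 ->
  let B := subarray A i1 i2 j1 j2 in
  nat_run (ext A) n i1 (i2 - i1).+1 j1 (j2 - j1).+1 (hper B) (vper B).
Proof.
case/and5P=> i12 j12 hB vB /and4P[_ /forallP D /forallP L /forallP R] B.
have [HB minp] := hper_period B; have [VB minq] := vper_period B.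
have [p0 H] := hperiodP _ _ _ _ _ _ HB; have [q0 V] := vperiodP _ _ _ _ _ _ VB.
have i2n := ltn_ord i2; have j2n := ltn_ord j2.
split=> //; try lia.
- move=> d /andP[d0 dp] Hd; have : hper B <= d by apply: minp; apply/hperiodP.
  by lia.
- move=> d /andP[d0 dp] Hd; have : vper B <= d by apply: minq; apply/vperiodP.
  by lia.
- move=> lt; have lt2 : i2.+1 < n by lia.
  move=> bi; have := D (Ordinal lt2); rewrite eqxx => /negP; apply.
  apply: same_periods_ext; rewrite ?leqnn ?leqnSn //=.
  by rewrite subSn.
- move=> j0; have lt2 : j1.-1 < n by lia.
  have lt2E : (Ordinal lt2).+1 == j1 by rewrite /= prednK.
  move=> bi; have /implyP/(_ lt2E)/negP := L (Ordinal lt2); apply.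
  apply: same_periods_ext; rewrite ?leqnn ?leq_pred //=.
  have -> : j2 - j1.-1 = (j2 - j1).+1 by lia.
  exact: bi.
- move=> lt; have lt2 : j2.+1 < n by lia.
  move=> bi; have := R (Ordinal lt2); rewrite eqxx => /negP; apply.
  apply: same_periods_ext; rewrite ?leqnn ?leqnSn //=.
  by rewrite subSn.
Qed.

End Bridge.

(** * Counting the codes *)

Lemma card_runs2D (T : eqType) n (A : 'M[T]_(n, n)) :
  #|runs2D A| <= n ^ 2 * (trunc_log 2 n).+1 ^ 2 * 4.
Proof.
pose L := (trunc_log 2 n).+1.
(* A code consists of the top row and the anchor column, the scales of the two periods, and their
   two ranks. *)
have -> : n ^ 2 * (trunc_log 2 n).+1 ^ 2 * 4 =
    #|{: ('I_n * 'I_n) * ('I_L * 'I_L) * (bool * bool)}|.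
  by rewrite !card_prod !card_ord card_bool !mulnn.
pose P (u : ('I_n * 'I_n) * ('I_n * 'I_n))
    (w : ('I_n * 'I_n) * ('I_L * 'I_L) * (bool * bool)) :=
  exists p q, let i := u.1.1 in let x := w.1.1.2 in
    let r := (u.1.2 - u.1.1).+1 in let c := (u.2.2 - u.2.1).+1 in
  [/\ u.1.1 <= u.1.2 /\ u.2.1 <= u.2.2,
      nat_run (ext A) n i r u.2.1 c p q, anchor (ext A) n i r u.2.1 c p q x,
      i = w.1.1.1 /\ (trunc_log 2 p = w.1.2.1 /\ trunc_log 2 q = w.1.2.2)
    & w.2 = square_ranks (ext A) i x p q].
apply: (@leq_card_rel _ _ _ P).
  move=> [[i1 i2] [j1 j2]]; rewrite inE /= => run.
  have [p [q B]] : exists p q,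
      nat_run (ext A) n i1 (i2 - i1).+1 j1 (j2 - j1).+1 p q.
    by eexists; eexists; apply: is_2Drun_nat_run run.
  case/and3P: run => i12 j12 _.
  have [x Ax] := anchor_exists B; have [jx xc _] := Ax.
  have p0 := run_p_gt0 B; have cn := run_right B.
  have xn : x < n by lia.
  have logL k : k <= n -> trunc_log 2 k < L.
    by move=> kn; rewrite ltnS; apply: leq_trunc_log.
  have pL : trunc_log 2 p < L by apply: logL; lia.
  have qL : trunc_log 2 q < L.
    by apply: logL; have := run_height B; have := run_bottom B; lia.
  by exists ((i1, Ordinal xn), (Ordinal pL, Ordinal qL),
    square_ranks (ext A) i1 x p q), p, q.
move=> [[i1 i2] [j1 j2]] [[i1' i2'] [j1' j2']] [[[i x] [e b]] ranks] /=.
case=> p [q [[/= i12 j12] B Ax [Ei [Ep Eq]] Ek]].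
case=> p' [q' [[/= i12' j12'] B' Ax' [Ei' [Ep' Eq']] Ek']].
subst i i1'.
have [Er Ej Ec] := run_inj B Ax B' Ax' (etrans Ep (esym Ep')) (etrans Eq (esym Eq'))
  (etrans (esym Ek) Ek').
have -> : i2 = i2' by apply: val_inj => /=; lia.
have -> : j1 = j1' by apply: val_inj.
by have -> : j2 = j2' by apply: val_inj => /=; lia.
Qed.

(** * The asymptotic bound *)

Local Open Scope ring_scope.

(** For [n >= 2] the binary logarithm of [n] is at least 1, so the added one costs at most a factor
    2. *)
Lemma trunc_log_le_ln (R : realType) n :
  (1 < n)%N -> (trunc_log 2 n).+1%:R <= 2 / ln 2 * ln n%:R :> R.
Proof.
move=> n1; have n0 : (0 < n)%N by apply: ltnW.
have ln2 : 0 < ln 2 :> R by rewrite ln_gt0 // ltr1n.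
have le_ln : ln 2 <= ln n%:R :> R by rewrite ler_ln ?posrE ?ltr0n // ler_nat.
have le_trunc : (trunc_log 2 n)%:R * ln 2 <= ln n%:R :> R.
  rewrite mulr_natl -lnXn // -natrX ler_ln ?posrE ?ltr0n ?expn_gt0 //.
  by rewrite ler_nat trunc_logP.
rewrite mulrAC ler_pdivlMr // -natr1 mulrDl mul1r; lra.
Qed.

Theorem theorem9 (R : realType) :
  exists (C : R) (n0 : nat),
    forall (T : eqType) (n : nat) (A : 'M[T]_(n, n)), (n0 <= n)%N ->
      #|runs2D A|%:R <= C * (n%:R ^+ 2 * ln (n%:R : R) ^+ 2).
Proof.
(* The factor 4 counts the pairs of ranks; the square comes from the two scales. *)
exists (4 * (2 / ln 2) ^+ 2), 2%N => T n A n1.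
have := card_runs2D A; rewrite -(ler_nat R) => /le_trans; apply.
rewrite !natrM -!expr2.
have H := trunc_log_le_ln R n1.
have {}H : (trunc_log 2 n).+1%:R ^+ 2 <= (2 / ln 2 * ln n%:R) ^+ 2 :> R.
  by rewrite ler_pXn2r // nnegrE ?ler0n // (le_trans _ H) ?ler0n.
have -> : 4 * (2 / ln 2) ^+ 2 * (n%:R ^+ 2 * ln n%:R ^+ 2) =
    n%:R ^+ 2 * (2 / ln 2 * ln n%:R) ^+ 2 * 4 :> R.
  by rewrite exprMn; ring.
by rewrite ler_wpM2r // ler_wpM2l // exprn_ge0.
Qed.
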